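(* Let $\mathcal{C}$ be a category with kernel pairs and split pullbacks. The following are equivalent: (i'') every reflexive strong relation in $\mathcal{C}$ is an equivalence relation; (ii'') every reflexive strong relation in $\mathcal{C}$ is a preorder; (iii'') every reflexive strong relation in $\mathcal{C}$ is transitive; (iv'') every strong relation in $\mathcal{C}$ is difunctional; (v'') for all morphisms $f\colon A\to B$, $r\colon B\to A$, $g\colon C\to B$, $s\colon B\to C$, $\alpha\colon A\to D$, $\beta\colon B\to D$, $\gamma\colon C\to D$ in $\mathcal{C}$ with $fr=1_B=gs$ and $\alpha r=\beta=\gamma s$, and for every strong relation $D_0\xleftarrow{d} D\xrightarrow{c} D_0'$ in $\mathcal{C}$ such that $d\alpha=d\beta f$ and $c\gamma=c\beta g$, there is a unique morphism $\varphi\colon A\times_B C\to D$ such that $$\varphi e_1=\alpha,\quad \varphi e_2=\gamma,\quad d\varphi=d\gamma\pi_2,\quad c\varphi=c\alpha\pi_1,$$ where $A\times_B C$ is the pullback of $f$ and $g$ with projections $\pi_1\colon A\times_BC\to A$, $\pi_2\colon A\times_BC\to C$, and $e_1=\langle 1_A, sf\rangle\colon A\to A\times_B C$, $e_2=\langle rg,1_C\rangle\colon C\to A\times_B C$.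
   Context: A category $\mathcal{C}$ has kernel pairs if the pullback of any morphism along itself exists; it has split pullbacks if the pullback of a split epimorphism along a split epimorphism always exists. No binary products are assumed. $\langle\cdot,\cdot\rangle$ denotes a morphism induced into a pullback. A relation is a span $D_0\xleftarrow{d}D\xrightarrow{c}D_0'$ whose legs $d,c$ are jointly monomorphic. A strong relation is a span whose legs are jointly strongly monomorphic: they are jointly monomorphic and, for every epimorphism $q\colon X\to Y$ and all morphisms $u\colon X\to D$, $v\colon Y\to D_0$, $v'\colon Y\to D_0'$ with $du=vq$ and $cu=v'q$, there is a (unique) $w\colon Y\to D$ with $wq=u$, $dw=v$, $cw=v'$. A reflexive graph in $\mathcal{C}$ consists of $d,c\colon C_1\to C_0$, $e\colon C_0\to C_1$ with $de=1_{C_0}=ce$. A multiplicative graph is a reflexive graph together with $m\colon C_2\to C_1$, where $C_2$ is the pullback of $d$ and $c$, with projections $\pi_1,\pi_2$, $d\pi_1=c\pi_2$, such that $m\langle 1_{C_1},ed\rangle=1_{C_1}=m\langle ec,1_{C_1}\rangle$, $dm=d\pi_2$, $cm=c\pi_1$. An internal category is a multiplicative graph satisfying $m(1\times m)=m(m\times 1)$. An internal groupoid is an internal category for which there is $t\colon C_1\to C_1$ with $ct=d$, $dt=c$, $m\langle 1_{C_1},t\rangle=ec$, $m\langle t,1_{C_1}\rangle=ed$. A reflexive (strong) relation is a reflexive graph with $(d,c)$ jointly (strongly) monomorphic. A reflexive relation is transitive if it admits a multiplicative graph structure $m$; it is a preorder (reflexive and transitive relation) if it underlies an internal category (or multiplicative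 graph); it is an equivalence relation if it underlies an internal groupoid. A pregroupoid structure on a span $D_0\xleftarrow{d}D\xrightarrow{c}D_0'$ is a morphism $p\colon D\times_{D_0}D\times_{D_0'}D\to D$, where the domain is the pullback of the second projection of the kernel pair $D\times_{D_0}D$ of $d$ along the first projection of the kernel pair $D\times_{D_0'}D$ of $c$ (generalised elements: triples $(x,y,z)$ with $dx=dy$, $cy=cz$), such that $p(x,y,y)=x$ (when $dx=dy$), $p(x,x,y)=y$ (when $cx=cy$), $dp(x,y,z)=dz$ and $cp(x,y,z)=cx$. A relation is difunctional if it admits a pregroupoid structure. *)

(* Defs.v *)
From mathcomp Require Import all_boot.

Set Implicit Arguments.
Unset Strict Implicit.
Unset Printing Implicit Defensive.

Declare Scope cat_scope.
Delimit Scope cat_scope with cat.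
Local Open Scope cat_scope.

Record category := Category {
  obj :> Type;
  hom : obj -> obj -> Type;
  idm : forall A, hom A A;
  compm : forall A B D, hom B D -> hom A B -> hom A D;
  compmA : forall A B D E (h : hom D E) (g : hom B D) (f : hom A B),
    compm h (compm g f) = compm (compm h g) f;
  comp1m : forall A B (f : hom A B), compm (idm B) f = f;
  compm1 : forall A B (f : hom A B), compm f (idm A) = f }.

Arguments hom {_} _ _.
Arguments idm {_} A.
Arguments compm {_ A B D} g f : rename.
Notation "g ∘ f" := (compm g f) (at level 40, left associativity) : cat_scope.

Definition epi (C : category) (X Y : C) (q : hom X Y) : Prop :=
  forall (Z : C) (u v : hom Y Z), u ∘ q = v ∘ q -> u = v.

Definition split_epi (C : category) (A B : C) (f : hom A B) : Prop :=
  exists r : hom B A, f ∘ r = idm B.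

Record pullback (C : category) (A B D : C) (f : hom A D) (g : hom B D) := Pullback {
  pb_obj :> C;
  pr1 : hom pb_obj A;
  pr2 : hom pb_obj B;
  pb_comm : f ∘ pr1 = g ∘ pr2;
  pb_pair : forall (X : C) (u : hom X A) (v : hom X B),
    f ∘ u = g ∘ v -> hom X pb_obj;
  pb_pair1 : forall X (u : hom X A) (v : hom X B) (uv : f ∘ u = g ∘ v),
    pr1 ∘ pb_pair uv = u;
  pb_pair2 : forall X (u : hom X A) (v : hom X B) (uv : f ∘ u = g ∘ v),
    pr2 ∘ pb_pair uv = v;
  pb_uniq : forall X (h k : hom X pb_obj),
    pr1 ∘ h = pr1 ∘ k -> pr2 ∘ h = pr2 ∘ k -> h = k }.

Arguments pr1 {_ _ _ _ _ _} p.
Arguments pr2 {_ _ _ _ _ _} p.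
Arguments pb_pair {_ _ _ _ _ _} p {X} u v uv : rename.

Definition has_kernel_pairs (C : category) : Prop :=
  forall (A B : C) (f : hom A B), inhabited (pullback f f).

Definition has_split_pullbacks (C : category) : Prop :=
  forall (A B D : C) (f : hom A D) (g : hom B D),
    split_epi f -> split_epi g -> inhabited (pullback f g).

Definition relation (C : category) (D D0 D0' : C)
    (d : hom D D0) (c : hom D D0') : Prop :=
  forall (X : C) (u v : hom X D), d ∘ u = d ∘ v -> c ∘ u = c ∘ v -> u = v.

Definition strong_relation (C : category) (D D0 D0' : C)
    (d : hom D D0) (c : hom D D0') : Prop :=
  relation d c /\
  forall (X Y : C) (q : hom X Y), epi q ->
  forall (u : hom X D) (v : hom Y D0) (v' : hom Y D0'),
    d ∘ u = v ∘ q -> c ∘ u = v' ∘ q ->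
    exists! w : hom Y D, w ∘ q = u /\ d ∘ w = v /\ c ∘ w = v'.

Record reflexive_graph (C : category) := ReflexiveGraph {
  rg0 : C;
  rg1 : C;
  rg_d : hom rg1 rg0;
  rg_c : hom rg1 rg0;
  rg_e : hom rg0 rg1;
  rg_de : rg_d ∘ rg_e = idm rg0;
  rg_ce : rg_c ∘ rg_e = idm rg0 }.

(* Side conditions for the morphisms <1, s f> and <r g, 1> into the pullback
   of two split epimorphisms f, g with sections r, s. *)
Lemma section_pair1 (C : category) (A B D : C) (f : hom A B) (g : hom D B)
  (s : hom B D) : g ∘ s = idm B -> f ∘ idm A = g ∘ (s ∘ f).
Proof. by move=> gs; rewrite compm1 compmA gs comp1m. Qed.

Lemma section_pair2 (C : category) (A B D : C) (f : hom A B) (g : hom D B)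
  (r : hom B A) : f ∘ r = idm B -> f ∘ (r ∘ g) = g ∘ idm D.
Proof. by move=> fr; rewrite compm1 compmA fr comp1m. Qed.

Definition pair_inl (C : category) (A B D : C) (f : hom A B) (g : hom D B)
    (P : pullback f g) (s : hom B D) (gs : g ∘ s = idm B) : hom A P :=
  pb_pair P (idm A) (s ∘ f) (section_pair1 f gs).

Definition pair_inr (C : category) (A B D : C) (f : hom A B) (g : hom D B)
    (P : pullback f g) (r : hom B A) (fr : f ∘ r = idm B) : hom D P :=
  pb_pair P (r ∘ g) (idm D) (section_pair2 g fr).

Record multiplicative_graph (C : category) (G : reflexive_graph C) :=
  MultiplicativeGraph {
  mg2 : pullback (rg_d G) (rg_c G);
  mg_m : hom mg2 (rg1 G);
  mg_m1 : mg_m ∘ pair_inl mg2 (rg_ce G) = idm (rg1 G);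
  mg_1m : mg_m ∘ pair_inr mg2 (rg_de G) = idm (rg1 G);
  mg_dm : rg_d G ∘ mg_m = rg_d G ∘ pr2 mg2;
  mg_cm : rg_c G ∘ mg_m = rg_c G ∘ pr1 mg2 }.

Section Associativity.
Variables (C : category) (G : reflexive_graph C) (M : multiplicative_graph G).
(* The object of composable triples (x, y, z), as pairs ((x, y), (y, z)). *)
Variable C3 : pullback (pr2 (mg2 M)) (pr1 (mg2 M)).

Lemma one_times_m_subproof :
  rg_d G ∘ (pr1 (mg2 M) ∘ pr1 C3) = rg_c G ∘ (mg_m M ∘ pr2 C3).
Proof. by rewrite !compmA mg_cm pb_comm -!compmA pb_comm. Qed.

Lemma m_times_one_subproof :
  rg_d G ∘ (mg_m M ∘ pr1 C3) = rg_c G ∘ (pr2 (mg2 M) ∘ pr2 C3).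
Proof. by rewrite !compmA mg_dm -pb_comm -!compmA pb_comm. Qed.

Definition one_times_m : hom C3 (mg2 M) :=
  pb_pair (mg2 M) (pr1 (mg2 M) ∘ pr1 C3) (mg_m M ∘ pr2 C3) one_times_m_subproof.

Definition m_times_one : hom C3 (mg2 M) :=
  pb_pair (mg2 M) (mg_m M ∘ pr1 C3) (pr2 (mg2 M) ∘ pr2 C3) m_times_one_subproof.
End Associativity.

Record internal_category (C : category) (G : reflexive_graph C) :=
  InternalCategory {
  ic_mg :> multiplicative_graph G;
  ic3 : pullback (pr2 (mg2 ic_mg)) (pr1 (mg2 ic_mg));
  ic_assoc : mg_m ic_mg ∘ one_times_m ic3 = mg_m ic_mg ∘ m_times_one ic3 }.

Lemma inverse_pair1 (C : category) (A B : C) (d c : hom A B) (t : hom A A) :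
  c ∘ t = d -> d ∘ idm A = c ∘ t.
Proof. by move=> ->; rewrite compm1. Qed.

Lemma inverse_pair2 (C : category) (A B : C) (d c : hom A B) (t : hom A A) :
  d ∘ t = c -> d ∘ t = c ∘ idm A.
Proof. by move=> ->; rewrite compm1. Qed.

Record internal_groupoid (C : category) (G : reflexive_graph C) :=
  InternalGroupoid {
  ig_ic :> internal_category G;
  ig_t : hom (rg1 G) (rg1 G);
  ig_ct : rg_c G ∘ ig_t = rg_d G;
  ig_dt : rg_d G ∘ ig_t = rg_c G;
  ig_m1t :
    mg_m ig_ic ∘ pb_pair (mg2 ig_ic) (idm _) ig_t (inverse_pair1 ig_ct)
      = rg_e G ∘ rg_c G;
  ig_mt1 :
    mg_m ig_ic ∘ pb_pair (mg2 ig_ic) ig_t (idm _) (inverse_pair2 ig_dt)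
      = rg_e G ∘ rg_d G }.

Definition reflexive_strong_relation (C : category) (G : reflexive_graph C) : Prop :=
  strong_relation (rg_d G) (rg_c G).

Definition reflexive_relation (C : category) (G : reflexive_graph C) : Prop :=
  relation (rg_d G) (rg_c G).

Definition transitive_relation (C : category) (G : reflexive_graph C) : Prop :=
  reflexive_relation G /\ inhabited (multiplicative_graph G).

Definition preorder_relation (C : category) (G : reflexive_graph C) : Prop :=
  reflexive_relation G /\ inhabited (internal_category G).

Definition equivalence_relation (C : category) (G : reflexive_graph C) : Prop :=
  reflexive_relation G /\ inhabited (internal_groupoid G).

Section Pregroupoid.
Variables (C : category) (D D0 D0' : C) (d : hom D D0) (c : hom D D0').
Variables (Kd : pullback d d) (Kc : pullback c c).
Variable T : pullback (pr2 Kd) (pr1 Kc).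

Lemma diag_xyy_subproof :
  pr2 Kd ∘ idm Kd = pr1 Kc ∘ pb_pair Kc (pr2 Kd) (pr2 Kd) erefl.
Proof. by rewrite compm1 pb_pair1. Qed.

Lemma diag_xxy_subproof :
  pr2 Kd ∘ pb_pair Kd (pr1 Kc) (pr1 Kc) erefl = pr1 Kc ∘ idm Kc.
Proof. by rewrite compm1 pb_pair2. Qed.

(* (x, y) |-> (x, y, y) for d x = d y *)
Definition diag_xyy : hom Kd T := pb_pair T _ _ diag_xyy_subproof.

(* (x, y) |-> (x, x, y) for c x = c y *)
Definition diag_xxy : hom Kc T := pb_pair T _ _ diag_xxy_subproof.
End Pregroupoid.

Record pregroupoid (C : category) (D D0 D0' : C)
    (d : hom D D0) (c : hom D D0') := Pregroupoid {
  pg_Kd : pullback d d;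
  pg_Kc : pullback c c;
  pg_T : pullback (pr2 pg_Kd) (pr1 pg_Kc);
  pg_p : hom pg_T D;
  pg_xyy : pg_p ∘ diag_xyy pg_T = pr1 pg_Kd;
  pg_xxy : pg_p ∘ diag_xxy pg_T = pr2 pg_Kc;
  pg_dp : d ∘ pg_p = d ∘ (pr2 pg_Kc ∘ pr2 pg_T);
  pg_cp : c ∘ pg_p = c ∘ (pr1 pg_Kd ∘ pr1 pg_T) }.

Definition difunctional (C : category) (D D0 D0' : C)
    (d : hom D D0) (c : hom D D0') : Prop :=
  relation d c /\ inhabited (pregroupoid d c).

(* Main.v *)
(* On generalised elements, a relation (d, c) is difunctional iff d x = d y and
   c y = c z imply that some w has d w = d z and c w = c x; a reflexive relation
   is transitive iff d x = c y implies that some w has d w = d y and c w = c x.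
   Joint monicity makes every further equation automatic.

   For (iii'') => (iv''), call x and z related when some y has d y = d x and
   c y = c z. This is a reflexive relation, strong when (d, c) is, represented by
   the object of triples (x, y, z). If d x = d y and c y = c z, then z is related
   to y (through z) and y to x (through x); transitivity relates z to x through
   the required w.

   Conversely, in a reflexive difunctional relation composites are
   p (x, e (d x), z) and inverses are p (e (d x), x, e (c x)). *)
Require Import Defs.
From mathcomp Require Import all_boot.

Set Implicit Arguments.
Unset Strict Implicit.
Unset Printing Implicit Defensive.

Local Open Scope cat_scope.

Section Relations.
Variable C : category.

Definition difunctional_on_elements (D D0 D0' : C)
    (d : hom D D0) (c : hom D D0') : Prop :=
  forall (X : C) (x y z : hom X D), d ∘ x = d ∘ y -> c ∘ y = c ∘ z ->
  exists w : hom X D, d ∘ w = d ∘ z /\ c ∘ w = c ∘ x.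

Lemma kernel_pair_split1 (A B : C) (f : hom A B) (K : pullback f f) :
  split_epi (pr1 K).
Proof. by exists (pb_pair K (idm A) (idm A) erefl); rewrite pb_pair1. Qed.

Lemma kernel_pair_split2 (A B : C) (f : hom A B) (K : pullback f f) :
  split_epi (pr2 K).
Proof. by exists (pb_pair K (idm A) (idm A) erefl); rewrite pb_pair2. Qed.

Lemma pregroupoid_on_elements (D D0 D0' : C) (d : hom D D0) (c : hom D D0') :
  pregroupoid d c -> difunctional_on_elements d c.
Proof.
case=> Kd Kc T p _ _ dp cp X x y z dxy cyz.
have e : pr2 Kd ∘ pb_pair Kd x y dxy = pr1 Kc ∘ pb_pair Kc y z cyz.
  by rewrite pb_pair2 pb_pair1.
exists (p ∘ pb_pair T _ _ e); rewrite !compmA dp cp -!compmA.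
by rewrite pb_pair2 pb_pair1 pb_pair2 pb_pair1.
Qed.

Lemma multiplicative_graph_on_elements (G : reflexive_graph C) :
  multiplicative_graph G ->
  forall (X : C) (x y : hom X (rg1 G)), rg_d G ∘ x = rg_c G ∘ y ->
  exists w : hom X (rg1 G), rg_d G ∘ w = rg_d G ∘ y /\ rg_c G ∘ w = rg_c G ∘ x.
Proof.
case=> P m _ _ dm cm X x y dxy.
exists (m ∘ pb_pair P x y dxy).
by rewrite !compmA dm cm -!compmA pb_pair1 pb_pair2.
Qed.

Hypotheses (hK : has_kernel_pairs C) (hS : has_split_pullbacks C).

(** The diagonals split the projections of kernel pairs, so this pullback is a split one. It is the
    domain of a pregroupoid structure. *)
Lemma triples (D D0 D0' : C) (d : hom D D0) (c : hom D D0') :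
  exists (Kd : pullback d d) (Kc : pullback c c),
    inhabited (pullback (pr2 Kd) (pr1 Kc)).
Proof.
have [Kd] := hK d; have [Kc] := hK c; exists Kd, Kc.
by apply: hS; [apply: kernel_pair_split2 | apply: kernel_pair_split1].
Qed.

(** Evaluating the hypothesis at the generic triple, given by the three projections of [T], produces
    [p] itself. *)
Lemma difunctional_of_elements (D D0 D0' : C) (d : hom D D0) (c : hom D D0') :
  relation d c -> difunctional_on_elements d c -> difunctional d c.
Proof.
move=> R H; split=> //.
have [Kd [Kc [T]]] := triples d c.
have [||p [dp cp]] := H T (pr1 Kd ∘ pr1 T) (pr2 Kd ∘ pr1 T) (pr2 Kc ∘ pr2 T).
- by rewrite !compmA pb_comm.
- by rewrite pb_comm !compmA pb_comm.
constructor; exists Kd Kc T p => //; apply: R.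
- by rewrite compmA dp -!compmA pb_pair2 pb_pair2 pb_comm.
- by rewrite compmA cp -!compmA pb_pair1 compm1.
- by rewrite compmA dp -!compmA pb_pair2 compm1.
- by rewrite compmA cp -!compmA pb_pair1 pb_pair1 pb_comm.
Qed.

Lemma transitive_closed_difunctional (D D0 D0' : C)
    (d : hom D D0) (c : hom D D0') :
  (forall G : reflexive_graph C,
    reflexive_strong_relation G -> transitive_relation G) ->
  strong_relation d c -> difunctional d c.
Proof.
move=> trans [R S]; apply: difunctional_of_elements => //.
have [Kd [Kc [T]]] := triples d c.
pose x := pr1 Kd ∘ pr1 T; pose y := pr2 Kd ∘ pr1 T; pose z := pr2 Kc ∘ pr2 T.
have dxy : d ∘ x = d ∘ y by rewrite /x /y !compmA pb_comm.
have cyz : c ∘ y = c ∘ z by rewrite /y /z pb_comm !compmA pb_comm.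
(* [triple] and [xyz_inj] restate the universal property of [T] in components. With [dxy] and [cyz]
   they are all that is used of it, so [x], [y], [z] then become opaque. *)
have triple (X : C) (u v w : hom X D) : d ∘ u = d ∘ v -> c ∘ v = c ∘ w ->
    exists h : hom X T, [/\ x ∘ h = u, y ∘ h = v & z ∘ h = w].
  move=> duv cvw.
  have e : pr2 Kd ∘ pb_pair Kd u v duv = pr1 Kc ∘ pb_pair Kc v w cvw.
    by rewrite pb_pair2 pb_pair1.
  exists (pb_pair T _ _ e); rewrite /x /y /z -!compmA.
  by rewrite pb_pair1 pb_pair2 pb_pair1 !pb_pair2.
have xyz_inj (X : C) (h k : hom X T) :
    x ∘ h = x ∘ k -> y ∘ h = y ∘ k -> z ∘ h = z ∘ k -> h = k.
  rewrite /x /y /z -!compmA => xhk yhk zhk.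
  by apply: pb_uniq; apply: pb_uniq; rewrite // !compmA -pb_comm -!compmA.
clearbody x y z.
(* The outer components determine the middle one, since [d y = d x] and [c y = c z]. *)
have Txz : relation x z.
  move=> X h k xhk zhk; apply: xyz_inj => //.
  apply: R; first by rewrite !compmA -dxy -!compmA xhk.
  by rewrite !compmA cyz -!compmA zhk.
have [h [xh _ zh]] := triple D (idm D) (idm D) (idm D) erefl erefl.
(* The legs are swapped in the graph so that [rg_c] is the first component. *)
pose G := ReflexiveGraph zh xh.
have [|_ [M]] := trans G.
  split=> [X u v zuv xuv | X Y q qepi u v v' zu xu]; first exact: Txz.
  (* Only the middle component must be extended along [q]: its images under [d] and [c] already
     factor through [q], so strongness of [(d, c)] applies. *)
  have [||w [[wq [dw cw]] _]] := S X Y q qepi (y ∘ u) (d ∘ v') (c ∘ v).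
  - by rewrite compmA -dxy -!compmA xu.
  - by rewrite compmA cyz -!compmA zu.
  have [k [xk yk zk]] := triple Y v' w v (esym dw) cw.
  exists k; split=> [|k' [_ [zk' xk']]].
    by split=> //; apply: Txz; rewrite compmA ?xk ?zk.
  by apply: Txz; rewrite ?xk ?zk.
move=> X a b a' dab cba'.
(* The triples are [h1 = (a', a', b)] and [h2 = (b, a, a)]. Their composite [k] runs from [a'] to
   [a], and its middle component is the required element. *)
have [h1 [xh1 _ zh1]] := triple X a' a' b erefl (esym cba').
have [h2 [xh2 _ zh2]] := triple X b a a (esym dab) erefl.
have /= [|k [zk xk]] := multiplicative_graph_on_elements M (x := h1) (y := h2).
  by rewrite /= zh1 xh2.
exists (y ∘ k).
by rewrite !compmA -dxy cyz -!compmA zk xk xh1 zh2.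
Qed.

Lemma equivalence_of_elements (G : reflexive_graph C) :
  reflexive_relation G -> difunctional_on_elements (rg_d G) (rg_c G) ->
  equivalence_relation G.
Proof.
move=> R H; split=> //.
have [P] : inhabited (pullback (rg_d G) (rg_c G)).
  by apply: hS; exists (rg_e G); rewrite ?rg_de ?rg_ce.
have [||m [dm cm]] := H P (pr1 P) (rg_e G ∘ (rg_d G ∘ pr1 P)) (pr2 P).
- by rewrite compmA rg_de comp1m.
- by rewrite compmA rg_ce comp1m pb_comm.
have [||t [dt ct]] := H _ (rg_e G ∘ rg_d G) (idm (rg1 G)) (rg_e G ∘ rg_c G).
- by rewrite compmA rg_de comp1m compm1.
- by rewrite compmA rg_ce comp1m compm1.
have {}dt : rg_d G ∘ t = rg_c G by rewrite dt compmA rg_de comp1m.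
have {}ct : rg_c G ∘ t = rg_d G by rewrite ct compmA rg_ce comp1m.
have m1 : m ∘ pair_inl P (rg_ce G) = idm _.
  apply: R; rewrite compmA ?dm ?cm -!compmA ?pb_pair1 ?pb_pair2 ?compm1 //.
  by rewrite compmA rg_de comp1m.
have m2 : m ∘ pair_inr P (rg_de G) = idm _.
  apply: R; rewrite compmA ?dm ?cm -!compmA ?pb_pair1 ?pb_pair2 ?compm1 //.
  by rewrite compmA rg_ce comp1m.
pose M := MultiplicativeGraph m1 m2 dm cm.
(* The two unit insertions into [P] split its projections, so composable triples form a split
   pullback. *)
have [C3] : inhabited (pullback (pr2 (mg2 M)) (pr1 (mg2 M))).
  apply: hS.
    by exists (pair_inr P (rg_de G)); rewrite pb_pair2.
  by exists (pair_inl P (rg_ce G)); rewrite pb_pair1.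
have assoc : mg_m M ∘ one_times_m C3 = mg_m M ∘ m_times_one C3.
  apply: R; rewrite /= !compmA ?dm ?cm -!compmA ?pb_pair1 ?pb_pair2.
    by rewrite !compmA dm.
  by rewrite !compmA cm.
constructor; exists (InternalCategory assoc) t ct dt;
  apply: R; rewrite /= compmA ?dm ?cm -!compmA ?pb_pair1 ?pb_pair2 compmA
    ?rg_de ?rg_ce comp1m ?compm1 //.
Qed.

End Relations.

Theorem theorem2p8 (C : category)
    (hK : has_kernel_pairs C) (hS : has_split_pullbacks C) :
  [<->
    (forall G : reflexive_graph C,
      reflexive_strong_relation G -> equivalence_relation G);
    (forall G : reflexive_graph C,
      reflexive_strong_relation G -> preorder_relation G);
    (forall G : reflexive_graph C,
      reflexive_strong_relation G -> transitive_relation G);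
    (forall (D D0 D0' : C) (d : hom D D0) (c : hom D D0'),
      strong_relation d c -> difunctional d c);
    (forall (A B E D : C)
        (f : hom A B) (r : hom B A) (g : hom E B) (s : hom B E)
        (alpha : hom A D) (beta : hom B D) (gamma : hom E D)
        (fr : f ∘ r = idm B) (gs : g ∘ s = idm B),
      alpha ∘ r = beta -> gamma ∘ s = beta ->
      forall (D0 D0' : C) (d : hom D D0) (c : hom D D0'),
      strong_relation d c ->
      d ∘ alpha = d ∘ (beta ∘ f) -> c ∘ gamma = c ∘ (beta ∘ g) ->
      forall P : pullback f g,
      exists! phi : hom P D,
        phi ∘ pair_inl P gs = alpha /\
        phi ∘ pair_inr P fr = gamma /\
        d ∘ phi = d ∘ (gamma ∘ pr2 P) /\
        c ∘ phi = c ∘ (alpha ∘ pr1 P))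
  ].
Proof.
tfae.
- by move=> H G /H [R [I]]; split=> //; constructor; exact: I.
- by move=> H G /H [R [I]]; split=> //; constructor; exact: I.
- by move=> H D D0 D0' d c; apply: transitive_closed_difunctional.
- move=> H A B E D f r g s alpha beta gamma fr gs ar bs D0 D0' d c S da cg P.
  have [R [pg]] := H _ _ _ _ _ S.
  (* In elements, [phi (a, e)] is [p (alpha a, beta b, gamma e)], where [b = f a = g e]. *)
  have [||phi [dphi cphi]] := pregroupoid_on_elements pg
    (x := alpha ∘ pr1 P) (y := beta ∘ f ∘ pr1 P) (z := gamma ∘ pr2 P).
  + by rewrite !compmA da !compmA.
  + by rewrite -compmA pb_comm !compmA cg !compmA.
  exists phi; split=> [|psi [_ [_ [dpsi cpsi]]]].
    split; [|split=> //]; apply: R;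
      rewrite compmA ?dphi ?cphi -!compmA ?pb_pair1 ?pb_pair2 ?compm1 //.
      by rewrite (compmA gamma) bs da.
    by rewrite (compmA alpha) ar cg.
  by apply: R; rewrite ?dpsi ?cpsi.
- move=> H G S; have [R _] := S; apply: equivalence_of_elements => //.
  move=> X x y z dxy cyz.
  have [Kd [Kc [T]]] := triples hK hS (rg_d G) (rg_c G).
  have fr : pr2 Kd ∘ pb_pair Kd (idm _) (idm _) erefl = idm _ by exact: pb_pair2.
  have gs : pr1 Kc ∘ pb_pair Kc (idm _) (idm _) erefl = idm _ by exact: pb_pair1.
  (* With kernel pair projections for [f], [g], diagonals for [r], [s] and the identity for [beta],
     the pullback is [T], and [phi] is the pregroupoid operation. *)
  have [|||| phi [[_ [_ [dphi cphi]]] _]] :=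
    H _ _ _ _ _ _ _ _ (pr1 Kd) (idm _) (pr2 Kc) fr gs _ _ _ _ _ _ S _ _ T.
  + exact: pb_pair1.
  + exact: pb_pair2.
  + by rewrite comp1m pb_comm.
  + by rewrite comp1m pb_comm.
  have e : pr2 Kd ∘ pb_pair Kd x y dxy = pr1 Kc ∘ pb_pair Kc y z cyz.
    by rewrite pb_pair2 pb_pair1.
  exists (phi ∘ pb_pair T _ _ e); rewrite !compmA dphi cphi -!compmA.
  by rewrite pb_pair2 pb_pair1 pb_pair2 pb_pair1.
Qed.
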